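(* (Agreement) Let $n\ge 3f+1$ and consider any execution of an instance $\lambda$ of the IBFT algorithm among $n$ processes of which at most $f$ are faulty (Byzantine). If a correct process $p_i$ decides some value $v$, then no correct process $p_j$ decides a value $v'$ such that $v'\neq v$.
   Context: **System model.** There is a known set $\Pi=\{p_1,\dots,p_n\}$ of processes. A process following the algorithm is correct; otherwise it is faulty and may behave arbitrarily (Byzantine). At most $f$ processes are faulty, and $n\ge 3f+1$. The system is partially synchronous: there are an unknown bound $\Delta$ on execution and communication delays and an unknown time GST after which the bound holds. Messages sent before GST may be arbitrarily delayed or lost; a message sent by a correct process at time $t\ge$ GST is delivered by all correct processes (to which it is sent) by time $t+\Delta$. Broadcasting means sending to every process in $\Pi$, including oneself. **Messages.** For an instance $\lambda$, messages are $\langle\texttt{PRE-PREPARE},\lambda,r,v\rangle$, $\langle\texttt{PREPARE},\lambda,r,v\rangle$, $\langle\texttt{COMMIT},\lambda,r,v\rangle$ ($r$ a round, $v$ a value), and $\langle\texttt{ROUND-CHANGE},\lambda,r,pr,pv\rangle$ ($pr$ a prepared round, $pv$ a prepared value, both possibly $\bot$). A correct process accepts only valid messages. A message is valid if it carries an unforgeable proof of integrity and of its sender's identity (e.g. a digital signature), an externally provided predicate $\beta$ is true of the value it carries (if that value is not $\bot$), and, for $\langle\texttt{ROUND-CHANGE},\lambda,r,pr,pv\rangle$, $pr<r$ (or $pr=\bot$). A quorum of messages is a set of messages from $\lfloor\frac{n+f}{2}\rfloor+1$ different processes. A deterministic function $\mathrm{LEADER}(\lambda,r)\in\Pi$ gives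 the leader of round $r$. **State of a correct process $p_i$.** Instance $\lambda_i$; current round $r_i$; prepared round $pr_i$ and prepared value $pv_i$; input value $inputValue_i$; a timer. The timeout $t(r)$ is an exponential function of $r$. **Start($\lambda$, value).** Set $\lambda_i\gets\lambda$, $r_i\gets1$, $pr_i\gets\bot$, $pv_i\gets\bot$, $inputValue_i\gets value$. If $\mathrm{LEADER}(\lambda_i,r_i)=p_i$, broadcast $\langle\texttt{PRE-PREPARE},\lambda_i,r_i,inputValue_i\rangle$. Start the timer to expire after $t(r_i)$. **Upon rules** (each triggered at most once for any round $r_i$, except Rule 7, which may be triggered any number of times): 1. Upon receiving from $\mathrm{LEADER}(\lambda_i,r_i)$ a valid message $m=\langle\texttt{PRE-PREPARE},\lambda_i,r_i,v\rangle$ with $\mathrm{JustifyPrePrepare}(m)$ true: restart the timer to expire after $t(r_i)$ and broadcast $\langle\texttt{PREPARE},\lambda_i,r_i,v\rangle$. 2. Upon receiving a quorum of valid $\langle\texttt{PREPARE},\lambda_i,r_i,v\rangle$ messages (same $v$): set $pr_i\gets r_i$, $pv_i\gets v$, and broadcast $\langle\texttt{COMMIT},\lambda_i,r_i,v\rangle$. When this happens we say that $p_i$ prepares (has prepared) for round $r_i$ and value $v$. 3. Upon receiving a quorum $Q_{commit}$ of valid $\langle\texttt{COMMIT},\lambda_i,round,v\rangle$ messages (same $round$ and $v$; $round$ need not equal $r_i$): stop the timer and decide $v$. 4. Upon the timer expiring: set $r_i\gets r_i+1$, start the timer to expire after $t(r_i)$, broadcast $\langle\texttt{ROUND-CHANGE},\lambda_i,r_i,pr_i,pv_i\rangle$.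 5. Upon receiving valid ROUND-CHANGE messages for $\lambda_i$ from $f+1$ different processes, all with rounds $>r_i$: set $r_i$ to the smallest of these rounds, start the timer to expire after $t(r_i)$, broadcast $\langle\texttt{ROUND-CHANGE},\lambda_i,r_i,pr_i,pv_i\rangle$. 6. Upon receiving a quorum $Q_{rc}$ of valid $\langle\texttt{ROUND-CHANGE},\lambda_i,r_i,\cdot,\cdot\rangle$ messages with $\mathrm{LEADER}(\lambda_i,r_i)=p_i$ and $\mathrm{JustifyRoundChange}(Q_{rc})$ true: if some message in $Q_{rc}$ has prepared round $\ne\bot$, let $v$ be the value component of $\mathrm{HighestPrepared}(Q_{rc})$; otherwise let $v=inputValue_i$; broadcast $\langle\texttt{PRE-PREPARE},\lambda_i,r_i,v\rangle$. 7. Upon receiving a valid ROUND-CHANGE message for $\lambda_i$ from $p_j$, if $p_i$ has decided with quorum $Q_{commit}$: send $Q_{commit}$ to $p_j$. **Justification.** $\mathrm{HighestPrepared}(Q_{rc})$ is a pair $(pr,pv)$ occurring as prepared round and value of a message in $Q_{rc}$ whose prepared round is highest (every message in $Q_{rc}$ has prepared round $\bot$ or $\le pr$). $\mathrm{JustifyRoundChange}(Q_{rc})$ is true iff all messages in $Q_{rc}$ have prepared round and prepared value $\bot$, or the evaluating process has received a quorum of valid $\langle\texttt{PREPARE},\lambda,pr,pv\rangle$ messages with $(pr,pv)=\mathrm{HighestPrepared}(Q_{rc})$. $\mathrm{JustifyPrePrepare}(\langle\texttt{PRE-PREPARE},\lambda,r,v\rangle)$ is true iff $r=1$, or the evaluating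 process has received a quorum $Q_{rc}$ of valid $\langle\texttt{ROUND-CHANGE},\lambda,r,pr_j,pv_j\rangle$ messages such that either all of them have $pr_j=\bot$ and $pv_j=\bot$, or the process has received a quorum of valid $\langle\texttt{PREPARE},\lambda,pr,v\rangle$ messages with $(pr,v)=\mathrm{HighestPrepared}(Q_{rc})$. The messages serving as justification are piggybacked on the message they justify, and count as received by the recipient. *)

(* Defs.v *)
From HB Require Import structures.
From mathcomp Require Import all_boot all_order all_algebra.
From mathcomp Require Import reals.

Set Implicit Arguments.
Unset Strict Implicit.
Unset Printing Implicit Defensive.

Import Order.TTheory GRing.Theory Num.Theory.

Local Open Scope ring_scope.

Section Messages.

Variables (L V : eqType) (n : nat).

Inductive body :=
  | PrePrepare of L & nat & V
  | Prepare of L & nat & V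
  | Commit of L & nat & V
  | RoundChange of L & nat & option nat & option V.

Definition body_code (b : body) :
    (L * nat * V) + (L * nat * V) + (L * nat * V)
    + (L * nat * option nat * option V) :=
  match b with
  | PrePrepare l r v => inl (inl (inl (l, r, v)))
  | Prepare l r v => inl (inl (inr (l, r, v)))
  | Commit l r v => inl (inr (l, r, v))
  | RoundChange l r pr pv => inr (l, r, pr, pv)
  end.

Definition body_decode (x : (L * nat * V) + (L * nat * V) + (L * nat * V)
    + (L * nat * option nat * option V)) : body :=
  match x with
  | inl (inl (inl (l, r, v))) => PrePrepare l r v
  | inl (inl (inr (l, r, v))) => Prepare l r v
  | inl (inr (l, r, v)) => Commit l r v
  | inr (l, r, pr, pv) => RoundChange l r pr pv
  end.

Lemma body_codeK : cancel body_code body_decode.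
Proof. by case. Qed.

HB.instance Definition _ := Equality.copy body (can_type body_codeK).

(* [src] is the claimed sender.  [auth] tells whether the attached proof of
   integrity and of the sender's identity checks; that an authentic message
   cannot be forged is a restriction on faulty sends, see [StepFaulty]. *)
Record message := Message { src : 'I_n; auth : bool; content : body }.

Definition message_code (m : message) := (src m, auth m, content m).

Definition message_decode (x : 'I_n * bool * body) :=
  let: (p, a, b) := x in Message p a b.

Lemma message_codeK : cancel message_code message_decode.
Proof. by case. Qed.

HB.instance Definition _ := Equality.copy message (can_type message_codeK).

Definition is_round_change (l : L) (m : message) : bool :=
  if content m is RoundChange l' _ _ _ then l' == l else false.

Definition round_of (m : message) : nat :=
  match content m with
  | PrePrepare _ r _ | Prepare _ r _ | Commit _ r _ | RoundChange _ r _ _ => r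
  end.

(* Only meaningful on ROUND-CHANGE messages. *)
Definition prepared_of (m : message) : option nat * option V :=
  if content m is RoundChange _ _ pr pv then (pr, pv) else (None, None).

End Messages.

(* The contents of a transmission are a message together with the messages
   piggybacked on it, or a forwarded quorum. *)
Record transmission (R : realType) (L V : eqType) (n : nat) := Transmission {
  origin : 'I_n;
  dest : 'I_n;
  payload : seq (message L V n);
  sent_at : R }.

Section TransmissionEq.

Variables (R : realType) (L V : eqType) (n : nat).

Definition transmission_code (x : transmission R L V n) :=
  (origin x, dest x, payload x, sent_at x).

Definition transmission_decode (x : 'I_n * 'I_n * seq (message L V n) * R) :=
  let: (p, q, pl, a) := x in Transmission p q pl a.

Lemma transmission_codeK : cancel transmission_code transmission_decode.
Proof. by case. Qed.

HB.instance Definition _ :=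
  Equality.copy (transmission R L V n) (can_type transmission_codeK).

End TransmissionEq.

(* [timer] is the absolute time at which the timer expires, None when stopped.
   [fired] lists the pairs (rule number, round in which it was triggered).
   [decided] lists the decisions together with the COMMIT quorums used. *)
Record local_state (R : realType) (L V : eqType) (n : nat) := LocalState {
  inst : L;
  rnd : nat;
  prnd : option nat;
  pval : option V;
  input_value : V;
  timer : option R;
  fired : seq (nat * nat);
  decided : seq (V * seq (message L V n)) }.

(* [run] is None until Start is called.  [rcvd] collects the accepted messages
   (also those arriving before Start); [rc_pending] holds the accepted
   ROUND-CHANGE messages not yet answered with a COMMIT quorum. *)
Record process_state (R : realType) (L V : eqType) (n : nat) := ProcessState {
  run : option (local_state R L V n);
  rcvd : seq (message L V n);
  rc_pending : seq (message L V n) }.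

Record config (R : realType) (L V : eqType) (n : nat) := Config {
  states : {ffun 'I_n -> process_state R L V n};
  network : seq (transmission R L V n) }.

Inductive rule (L V : eqType) (n : nat) :=
  | R1 | R2 | R3 | R4 | R5 | R6
  | R7 of message L V n.
Arguments R1 {L V n}.
Arguments R2 {L V n}.
Arguments R3 {L V n}.
Arguments R4 {L V n}.
Arguments R5 {L V n}.
Arguments R6 {L V n}.

Inductive event (R : realType) (L V : eqType) (n : nat) :=
  | Start of 'I_n & V
  | Receive of transmission R L V n
  | Upon of 'I_n & rule L V n
  | FaultySend of transmission R L V n
  | Idle.
Arguments Start {R L V n}.
Arguments Upon {R L V n}.
Arguments Idle {R L V n}.

Definition exponential (R : realType) (t : nat -> R) : Prop :=
  exists c b : R, [/\ 0 < c, 1 < b & forall r, t r = c * b ^+ r].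

Section IBFT.

Variables (R : realType) (L V : eqType) (n f : nat).
Variables (leader : L -> nat -> 'I_n) (beta : pred V) (t : nat -> R).

Local Notation message := (message L V n).
Local Notation transmission := (transmission R L V n).
Local Notation local_state := (local_state R L V n).
Local Notation process_state := (process_state R L V n).
Local Notation config := (config R L V n).
Local Notation rule := (rule L V n).
Local Notation event := (event R L V n).

Definition valid (m : message) : bool :=
  auth m &&
  match content m with
  | PrePrepare _ _ v | Prepare _ _ v | Commit _ _ v => beta v
  | RoundChange _ r pr pv =>
      (if pv is Some v then beta v else true) &&
      (if pr is Some r' then (r' < r)%N else true)
  end.

(* Q consists of messages of [rcv], one from each of k different processes. *)
Definition from_distinct (k : nat) (rcv Q : seq message) : bool :=
  [&& all [in rcv] Q, uniq [seq src m | m <- Q] & size Q == k].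

Definition quorum (rcv Q : seq message) : bool :=
  from_distinct ((n + f) %/ 2).+1 rcv Q.

Definition quorum_of (b : body L V) (rcv Q : seq message) : bool :=
  quorum rcv Q && all (fun m => content m == b) Q.

Definition round_change_quorum (l : L) (r : nat) (rcv Q : seq message) : bool :=
  quorum rcv Q && all (fun m => is_round_change l m && (round_of m == r)) Q.

Definition le_prepared (a b : option nat) : bool :=
  match a, b with
  | None, _ => true
  | Some x, Some y => (x <= y)%N
  | Some _, None => false
  end.

(* [h] is a possible value of HighestPrepared(Q).  It need not be unique, as
   faulty processes may report different values for the same round. *)
Definition highest_prepared (Q : seq message) (h : option nat * option V) : bool :=
  (h \in [seq prepared_of m | m <- Q]) &&
  all (fun m => le_prepared (prepared_of m).1 h.1) Q.

Definition all_unprepared (Q : seq message) : bool :=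
  all (fun m => prepared_of m == (None, None)) Q.

(* [h] is the value of HighestPrepared(Q). *)
Definition justify_round_change (rcv : seq message) (l : L) (Q : seq message)
    (h : option nat * option V) : Prop :=
  all_unprepared Q \/
  exists pr pv Qp,
    h = (Some pr, Some pv) /\ quorum_of (Prepare l pr pv) rcv Qp.

Definition justify_pre_prepare (rcv : seq message) (l : L) (r : nat) (v : V) :
    Prop :=
  r = 1%N \/
  exists Q h,
    [/\ round_change_quorum l r rcv Q, highest_prepared Q h &
        all_unprepared Q \/
        exists pr Qp,
          h = (Some pr, Some v) /\ quorum_of (Prepare l pr v) rcv Qp].

(* J is the set of PREPARE messages piggybacked as evidence for (pr, pv). *)
Definition prepare_evidence (rcv : seq message) (l : L)
    (h : option nat * option V) (J : seq message) : Prop :=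
  match h with
  | (Some pr, Some pv) => quorum_of (Prepare l pr pv) rcv J
  | _ => J = [::]
  end.

Definition broadcast (p : 'I_n) (now : R) (b : body L V) (J : seq message) :
    seq transmission :=
  [seq Transmission p q (Message p true b :: J) now | q <- enum 'I_n].

Definition set_timer (d : option R) (s : local_state) : local_state :=
  LocalState (inst s) (rnd s) (prnd s) (pval s) (input_value s) d (fired s)
    (decided s).

Definition set_round (r : nat) (s : local_state) : local_state :=
  LocalState (inst s) r (prnd s) (pval s) (input_value s) (timer s) (fired s)
    (decided s).

Definition set_prepared (pr : nat) (pv : V) (s : local_state) : local_state :=
  LocalState (inst s) (rnd s) (Some pr) (Some pv) (input_value s) (timer s)
    (fired s) (decided s).

Definition add_fired (k r : nat) (s : local_state) : local_state :=
  LocalState (inst s) (rnd s) (prnd s) (pval s) (input_value s) (timer s)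
    ((k, r) :: fired s) (decided s).

Definition add_decision (v : V) (Q : seq message) (s : local_state) :
    local_state :=
  LocalState (inst s) (rnd s) (prnd s) (pval s) (input_value s) (timer s)
    (fired s) ((v, Q) :: decided s).

Definition start_state (now : R) (l : L) (v : V) : local_state :=
  LocalState l 1 None None v (Some (now + t 1%N)) [::] [::].

Definition start_output (p : 'I_n) (now : R) (l : L) (v : V) :
    seq transmission :=
  if leader l 1 == p then broadcast p now (PrePrepare l 1 v) [::] else [::].

Definition rule_number (rl : rule) : nat :=
  match rl with
  | R1 => 1 | R2 => 2 | R3 => 3 | R4 => 4 | R5 => 5 | R6 => 6 | R7 _ => 7
  end.

(* [upon p now rcv s rl s' out]: at time [now], process p in state s, having
   accepted the messages rcv, can trigger rl (one of R1 to R6), which leads to state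
   s' and sends out.  The restriction to one triggering per round is in
   [process_step]. *)
Inductive upon (p : 'I_n) (now : R) (rcv : seq message) (s : local_state) :
    rule -> local_state -> seq transmission -> Prop :=
  | Upon1 v :
      Message (leader (inst s) (rnd s)) true (PrePrepare (inst s) (rnd s) v)
        \in rcv ->
      justify_pre_prepare rcv (inst s) (rnd s) v ->
      upon p now rcv s R1
        (set_timer (Some (now + t (rnd s))) s)
        (broadcast p now (Prepare (inst s) (rnd s) v) [::])
  | Upon2 v Q :
      quorum_of (Prepare (inst s) (rnd s) v) rcv Q ->
      upon p now rcv s R2
        (set_prepared (rnd s) v s)
        (broadcast p now (Commit (inst s) (rnd s) v) [::])
  | Upon3 r v Q :
      quorum_of (Commit (inst s) r v) rcv Q ->
      upon p now rcv s R3 (add_decision v Q (set_timer None s)) [::]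
  | Upon4 d J :
      timer s = Some d -> d <= now ->
      prepare_evidence rcv (inst s) (prnd s, pval s) J ->
      upon p now rcv s R4
        (set_timer (Some (now + t (rnd s).+1)) (set_round (rnd s).+1 s))
        (broadcast p now
           (RoundChange (inst s) (rnd s).+1 (prnd s) (pval s)) J)
  | Upon5 F r J :
      from_distinct f.+1 rcv F ->
      all (fun m => is_round_change (inst s) m && (rnd s < round_of m)%N) F ->
      r \in [seq round_of m | m <- F] ->
      all (fun m => (r <= round_of m)%N) F ->
      prepare_evidence rcv (inst s) (prnd s, pval s) J ->
      upon p now rcv s R5
        (set_timer (Some (now + t r)) (set_round r s))
        (broadcast p now (RoundChange (inst s) r (prnd s) (pval s)) J)
  | Upon6 Q h v J :
      round_change_quorum (inst s) (rnd s) rcv Q ->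
      leader (inst s) (rnd s) = p ->
      highest_prepared Q h ->
      justify_round_change rcv (inst s) Q h ->
      (if has (fun m => (prepared_of m).1 != None) Q
       then h.2 = Some v else v = input_value s) ->
      prepare_evidence rcv (inst s) h J ->
      upon p now rcv s R6 s
        (broadcast p now (PrePrepare (inst s) (rnd s) v) (Q ++ J)).

Inductive process_step (p : 'I_n) (now : R) (ps : process_state) :
    rule -> process_state -> seq transmission -> Prop :=
  | ProcessStep rl s s' out :
      run ps = Some s ->
      (rule_number rl, rnd s) \notin fired s ->
      upon p now (rcvd ps) s rl s' out ->
      process_step p now ps rl
        (ProcessState (Some (add_fired (rule_number rl) (rnd s) s'))
           (rcvd ps) (rc_pending ps))
        out
  | ProcessStep7 m s v Q :
      run ps = Some s ->
      m \in rc_pending ps ->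
      is_round_change (inst s) m ->
      (v, Q) \in decided s ->
      process_step p now ps (R7 m)
        (ProcessState (run ps) (rcvd ps) (rem m (rc_pending ps)))
        [:: Transmission p (src m) Q now].

Definition accept (pl : seq message) (ps : process_state) : process_state :=
  let acc := [seq m <- pl | valid m] in
  ProcessState (run ps) (rcvd ps ++ acc)
    (rc_pending ps ++
       [seq m <- acc | if content m is RoundChange _ _ _ _ then true else false]).

Definition update (c : config) (p : 'I_n) (ps : process_state)
    (out : seq transmission) : config :=
  Config [ffun q => if q == p then ps else states c q] (network c ++ out).

Definition initial_config : config :=
  Config [ffun=> ProcessState None [::] [::]] [::].

Section Executions.

Variables (l : L) (faulty : {set 'I_n}).

(* One event of an execution of instance l, taking place at time [now].  The
   network is the history of all transmissions, so nothing forces a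
   transmission to be received.  Faulty processes are unconstrained, except
   that an authentic message of a correct process can occur in their
   transmissions only if that process has sent it before. *)
Inductive step (now : R) (c : config) : event -> config -> Prop :=
  | StepStart p v :
      p \notin faulty ->
      run (states c p) = None ->
      step now c (Start p v)
        (update c p
           (ProcessState (Some (start_state now l v)) (rcvd (states c p))
              (rc_pending (states c p)))
           (start_output p now l v))
  | StepReceive x :
      x \in network c ->
      dest x \notin faulty ->
      step now c (Receive x)
        (update c (dest x) (accept (payload x) (states c (dest x))) [::])
  | StepUpon p rl ps out :
      p \notin faulty ->
      process_step p now (states c p) rl ps out ->
      step now c (Upon p rl) (update c p ps out)
  | StepFaulty x :
      origin x \in faulty ->
      sent_at x = now ->
      (forall m, m \in payload x -> auth m -> src m \notin faulty ->
         exists y, [/\ y \in network c, origin y = src m & m \in payload y]) ->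
      step now c (FaultySend x) (Config (states c) (rcons (network c) x))
  | StepIdle : step now c Idle c.

Definition enabled (now : R) (c : config) (p : 'I_n) (rl : rule) : Prop :=
  exists ps out, process_step p now (states c p) rl ps out.

(* Event number k takes place at time [tm k] and leads from [conf k] to
   [conf k.+1]; an execution with finitely many events is padded with [Idle]. *)
Record execution := Execution {
  conf : nat -> config;
  ev : nat -> event;
  tm : nat -> R }.

Definition run_of_algorithm (X : execution) : Prop :=
  [/\ conf X 0 = initial_config,
      forall k, step (tm X k) (conf X k) (ev X k) (conf X k.+1),
      forall k, tm X k <= tm X k.+1 &
      forall a, exists k, a <= tm X k].

(* [conf X k] is a configuration of the system at time a. *)
Definition in_force (X : execution) (k : nat) (a : R) : Prop :=
  a <= tm X k /\ forall j, (j < k)%N -> tm X j <= a.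

Definition communication_bound (X : execution) (gst delta : R) : Prop :=
  forall k x,
    x \in network (conf X k) ->
    origin x \notin faulty -> dest x \notin faulty -> gst <= sent_at x ->
    exists2 j, ev X j = Receive x & tm X j <= sent_at x + delta.

(* A rule enabled at time a >= gst is triggered, or ceases to be enabled, by
   time a + delta. *)
Definition execution_bound (X : execution) (gst delta : R) : Prop :=
  forall k a p rl,
    p \notin faulty -> gst <= a -> in_force X k a ->
    enabled a (conf X k) p rl ->
    exists j, [/\ (k <= j)%N, tm X j <= a + delta &
      ev X j = Upon p rl \/ ~ enabled (tm X j) (conf X j) p rl].

Definition partially_synchronous (X : execution) : Prop :=
  exists gst delta : R,
    [/\ 0 < delta, communication_bound X gst delta &
        execution_bound X gst delta].

Definition ibft_execution (X : execution) : Prop :=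
  run_of_algorithm X /\ partially_synchronous X.

End Executions.

Definition decides (X : execution) (p : 'I_n) (v : V) : Prop :=
  exists k s Q, run (states (conf X k) p) = Some s /\ (v, Q) \in decided s.

End IBFT.

(* Main.v *)
(** Two quorums share a correct process, and a correct process sends at most
    one PREPARE per round, so at most one value can be prepared in a round.
    Suppose a quorum sent COMMIT for (r, v).  By induction on r' >= r, a quorum
    of PREPARE messages for (r', v') forces v' = v: for r' > r, a correct
    sender of PREPARE holds a quorum of ROUND-CHANGE messages for r', one of
    which comes from a correct process that had already sent COMMIT in round r,
    and so reports a prepared round at least r.  The highest prepared pair
    (pr, v') in that quorum thus has r <= pr < r' and is backed by a PREPARE
    quorum, to which the induction hypothesis applies.  Two decisions are
    compared through the smaller of their two rounds. *)

Require Import Defs.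
From mathcomp Require Import all_boot all_order all_algebra.
From mathcomp Require Import reals zify.

Set Implicit Arguments.
Unset Strict Implicit.
Unset Printing Implicit Defensive.

(** * Quorum intersection, and monotonicity in the received messages *)

Lemma quorums_meet (n f : nat) (A B F : {set 'I_n}) :
  #|F| <= f -> (n + f) %/ 2 < #|A| -> (n + f) %/ 2 < #|B| ->
  exists q, [/\ q \in A, q \in B & q \notin F].
Proof.
move=> hF hA hB.
(* The two sizes add up to at least [n + f + 1], while the union has at most [n] elements. *)
have hAB : f < #|A :&: B|.
  have : #|A :|: B| <= n by rewrite -[leqRHS]card_ord max_card.
  have := cardsUI A B; lia.
have /subsetPn[q] : ~~ (A :&: B \subset F).
  by apply/negP => /subset_leq_card; lia.
by rewrite inE => /andP[qA qB] qF; exists q.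
Qed.

Section Agreement.

Variables (R : realType) (L V : eqType) (n f : nat).
Variables (leader : L -> nat -> 'I_n) (beta : pred V) (t : nat -> R).
Variables (l : L) (faulty : {set 'I_n}).

Local Notation message := (message L V n).
Local Notation config := (config R L V n).
Local Notation local_state := (local_state R L V n).

Lemma quorum_sub (rcv rcv' Q : seq message) :
  {subset rcv <= rcv'} -> quorum f rcv Q -> quorum f rcv' Q.
Proof.
move=> sub /and3P[/allP hQ uQ sQ]; apply/and3P; split=> //.
by apply/allP => m /hQ /sub.
Qed.

Lemma quorum_of_sub b (rcv rcv' Q : seq message) :
  {subset rcv <= rcv'} -> quorum_of f b rcv Q -> quorum_of f b rcv' Q.
Proof.
by move=> sub /andP[hQ hb]; rewrite /quorum_of hb (quorum_sub sub hQ).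
Qed.

Lemma justify_pre_prepare_sub (rcv rcv' : seq message) r v :
  {subset rcv <= rcv'} -> justify_pre_prepare f rcv l r v ->
  justify_pre_prepare f rcv' l r v.
Proof.
move=> sub [->|[Q [h [/andP[qQ aQ] hh J]]]]; [by left | right].
exists Q, h; split=> //; first by rewrite /round_change_quorum aQ (quorum_sub sub).
case: J => [?|[pr [Qp [-> hQp]]]]; [by left | right].
by exists pr, Qp; split=> //; apply: quorum_of_sub hQp.
Qed.

Lemma quorum_senders (rcv Q : seq message) :
  quorum f rcv Q -> (n + f) %/ 2 < #|[set q in [seq src m | m <- Q]]|.
Proof.
by case/and3P=> _ /card_uniqP uQ /eqP sQ; rewrite cardsE uQ size_map sQ.
Qed.

(** * Invariant of a single correct process *)

(* [S] is the set of the message bodies the process has authored so far; the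
   local state records neither these nor the values prepared earlier. *)
Record local_inv (S : body L V -> Prop) (rcv : seq message) (s : local_state) :
    Prop := LocalInv {
  inst_inv : inst s = l;
  rnd_gt0 : 0 < rnd s;
  prepare_fired : forall r v, S (Prepare l r v) -> (1, r) \in fired s;
  prepare_uniq : forall r v v',
    S (Prepare l r v) -> S (Prepare l r v') -> v = v';
  prepare_justified : forall r v,
    S (Prepare l r v) -> justify_pre_prepare f rcv l r v;
  commit_round : forall r v, S (Commit l r v) -> 0 < r <= rnd s;
  commit_prnd : forall r v, S (Commit l r v) -> le_prepared (Some r) (prnd s);
  commit_prepared : forall r v,
    S (Commit l r v) -> exists Q, quorum_of f (Prepare l r v) rcv Q;
  round_change_round : forall r pr pv,
    S (RoundChange l r pr pv) -> r <= rnd s;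
  round_change_commit : forall r pr pv r' v,
    S (RoundChange l r pr pv) -> S (Commit l r' v) -> r' < r ->
    le_prepared (Some r') pr;
  decided_commit : forall v Q,
    (v, Q) \in decided s -> exists r, quorum_of f (Commit l r v) rcv Q }.

(** Each clause has [S] only among its premises and [rcv] only in its conclusion, so the invariant
    is antitone in [S] and monotone in [rcv]. *)
Lemma local_inv_sub (S S' : body L V -> Prop) (rcv rcv' : seq message) s :
  (forall b, S' b -> S b) -> {subset rcv <= rcv'} ->
  local_inv S rcv s -> local_inv S' rcv' s.
Proof.
move=> subS sub [h1 h2 h3 h4 h5 h6 h7 h8 h9 h10 h11]; split=> //.
- by move=> r v /subS /h3.
- by move=> r v v' /subS h /subS h'; apply: h4 h h'.
- by move=> r v /subS /h5; apply: justify_pre_prepare_sub.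
- by move=> r v /subS /h6.
- by move=> r v /subS /h7.
- by move=> r v /subS /h8[Q hQ]; exists Q; apply: quorum_of_sub hQ.
- by move=> r pr pv /subS /h9.
- by move=> r pr pv r' v /subS h /subS h'; apply: h10 h h'.
- by move=> v Q /h11[r hQ]; exists r; apply: quorum_of_sub hQ.
Qed.

(** Piggybacked evidence and forwarded quorums must already be received, hence known to be genuine;
    only [B] extends what [p] has authored. *)
Definition authored_or_relayed (p : 'I_n) (B : body L V -> Prop)
    (rcv : seq message) (out : seq (transmission R L V n)) : Prop :=
  forall x, x \in out -> origin x = p /\
    forall m, m \in payload x ->
      m \in rcv \/ exists2 b, B b & m = Message p true b.

Lemma authored_broadcast p now b (J rcv : seq message) :
  {subset J <= rcv} ->
  authored_or_relayed p (eq b) rcv (broadcast p now b J).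
Proof.
move=> sub x /mapP[q _ ->]; split=> //= m.
by rewrite inE => /orP[/eqP->|/sub]; [right; exists b | left].
Qed.

Lemma quorum_subset (rcv Q : seq message) :
  quorum f rcv Q -> {subset Q <= rcv}.
Proof. by case/and3P=> /allP hQ _ _ m /hQ. Qed.

Lemma evidence_subset l' h (J rcv : seq message) :
  prepare_evidence f rcv l' h J -> {subset J <= rcv}.
Proof.
case: h => [[pr|] [pv|]] /=; try by move->.
by case/andP=> /quorum_subset.
Qed.

(** Common to the timeout and the [f + 1] rule. The new ROUND-CHANGE reports [prnd s], which by
    [commit_prnd] is at least the round of every COMMIT sent so far. *)
Lemma local_inv_round S rcv s r J now p d k :
  rnd s < r -> {subset J <= rcv} -> local_inv S rcv s ->
  exists B : body L V -> Prop,
    authored_or_relayed p B rcv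
      (broadcast p now (RoundChange (inst s) r (prnd s) (pval s)) J) /\
    local_inv (fun b => S b \/ B b) rcv
      (add_fired k (rnd s) (set_timer d (set_round r s))).
Proof.
move=> lt_r subJ [h1 h2 h3 h4 h5 h6 h7 h8 h9 h10 h11].
exists (eq (RoundChange (inst s) r (prnd s) (pval s))).
split; first exact: authored_broadcast.
split=> //=.
- by lia.
- by move=> r' v [/h3 h|//]; rewrite inE h orbT.
- by move=> r' v v' [h|//] [h'|//]; apply: h4 h h'.
- by move=> r' v [/h5|//].
- by move=> r' v [/h6|//]; lia.
- by move=> r' v [/h7|//].
- by move=> r' v [/h8|//].
- by move=> r' pr pv [/h9|[_ -> _ _]]; lia.
- move=> r' pr pv r'' v [h|[_ _ <- _]] [h'|//]; first exact: h10 h h'.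
  by move=> _; apply: h7 h'.
Qed.

Lemma upon_inv p now rcv s rl s' out S :
  upon f leader t p now rcv s rl s' out ->
  (rule_number rl, rnd s) \notin fired s ->
  local_inv S rcv s ->
  exists B : body L V -> Prop,
    authored_or_relayed p B rcv out /\
    local_inv (fun b => S b \/ B b) rcv
      (add_fired (rule_number rl) (rnd s) s').
Proof.
move=> up nfired inv; have [h1 h2 h3 h4 h5 h6 h7 h8 h9 h10 h11] := inv.
case: up nfired.
- move=> v _ just /= nfired.
  exists (eq (Prepare (inst s) (rnd s) v)); split; first exact: authored_broadcast.
  rewrite h1 in just *; split=> //=.
  + move=> r v' [/h3 h|[<- _]]; last by rewrite inE eqxx.
    by rewrite inE h orbT.
  (* An earlier PREPARE for the current round would have left [(1, rnd s)] in [fired s]. *)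
  + move=> r v1 v2 [ha|[<- <-]] [hb|]; [exact: h4 ha hb| | |by case].
    * by move: (h3 _ _ ha) => ha' [er _]; rewrite er ha' in nfired.
    * by move: (h3 _ _ hb); rewrite (negPf nfired).
  + by move=> r v' [/h5|[<- <-]].
  + by move=> r v' [/h6|].
  + by move=> r v' [/h7|].
  + by move=> r v' [/h8|].
  + by move=> r pr pv [/h9|].
  + by move=> r pr pv r' v' [h|//] [h'|//]; apply: h10 h h'.
- move=> v Q qQ nfired.
  exists (eq (Commit (inst s) (rnd s) v)); split; first exact: authored_broadcast.
  rewrite h1 in qQ *; split=> //=.
  + by move=> r v' [/h3 h|//]; rewrite inE h orbT.
  + by move=> r v1 v2 [h|//] [h'|//]; apply: h4 h h'.
  + by move=> r v' [/h5|].
  + by move=> r v' [/h6|[<- _]] //; rewrite h2 leqnn.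
  (* The prepared round becomes [rnd s], and no COMMIT sent so far is for a later round. *)
  + by move=> r v' [/h6/andP[]|[<- _]].
  + by move=> r v' [/h8|[<- <-]] //; exists Q.
  + by move=> r pr pv [/h9|].
  (* Past ROUND-CHANGE messages have rounds at most [rnd s], so none lies above the round of the new
     COMMIT. *)
  + move=> r pr pv r' v' [h|//] [h'|[<- _]]; first exact: h10 h h'.
    by move/h9: h; lia.
- move=> r v Q qQ nfired.
  exists (fun=> False); split=> //.
  apply: (@local_inv_sub S _ rcv) => //; first by move=> b [].
  split=> //= v' Q'; rewrite inE => /orP[/eqP[-> ->]|/h11//].
  by exists r; rewrite -h1.
- move=> d J _ _ /evidence_subset subJ _.
  exact: local_inv_round.
- move=> F r J _ /allP allF /mapP[m mF ->] _ /evidence_subset subJ _.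
  by apply: local_inv_round => //; case/andP: (allF _ mF).
- move=> Q h v J /andP[/quorum_subset subQ _] _ _ _ _ /evidence_subset subJ _.
  exists (eq (PrePrepare (inst s) (rnd s) v)); split.
    apply: authored_broadcast => m.
    by rewrite mem_cat => /orP[/subQ|/subJ].
  apply: (@local_inv_sub (fun b => S b \/ b = PrePrepare (inst s) (rnd s) v) _ rcv) => //.
    by move=> b [|<-]; [left|right].
  split=> //=.
  + by move=> r v' [/h3 e|//]; rewrite inE e orbT.
  + by move=> r v1 v2 [e|//] [e'|//]; apply: h4 e e'.
  + by move=> r v' [/h5|].
  + by move=> r v' [/h6|].
  + by move=> r v' [/h7|].
  + by move=> r v' [/h8|].
  + by move=> r pr pv [/h9|].
  + by move=> r pr pv r' v' [e|//] [e'|//]; apply: h10 e e'.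
Qed.

(** * Invariant of the whole system *)

(* A relayed message of [p] counts only if [p] itself is the origin of some
   transmission containing it. *)
Definition sent (c : config) (p : 'I_n) (b : body L V) : Prop :=
  exists x, [/\ x \in network c, origin x = p & Message p true b \in payload x].

Lemma sent_sub (c c' : config) p b :
  {subset network c <= network c'} -> sent c p b -> sent c' p b.
Proof. by move=> sub [x [/sub]]; exists x. Qed.

Definition genuine (c : config) (m : message) : Prop :=
  auth m -> src m \notin faulty -> sent c (src m) (content m).

(** Silence before Start is what makes the empty history of the start state agree with the
    network. *)
Definition process_inv (c : config) (p : 'I_n) : Prop :=
  (forall m, m \in rcvd (states c p) -> valid beta m /\ genuine c m) /\
  if run (states c p) is Some s
  then local_inv (sent c p) (rcvd (states c p)) s
  else forall b, ~ sent c p b.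

Definition config_inv (c : config) : Prop :=
  (forall x m, x \in network c -> m \in payload x -> genuine c m) /\
  (forall p, p \notin faulty -> process_inv c p).

Lemma genuine_sub (c c' : config) m :
  {subset network c <= network c'} -> genuine c m -> genuine c' m.
Proof. by move=> sub h a nf; apply: sent_sub (h a nf). Qed.

Lemma config_inv_initial : config_inv (initial_config R L V n).
Proof.
split=> [x m //|p _]; rewrite /process_inv ffunE /=; split=> // b [x []] //.
Qed.

Lemma process_inv_other (c c' : config) p :
  {subset network c <= network c'} ->
  states c' p = states c p ->
  (forall b, sent c' p b -> sent c p b) ->
  process_inv c p -> process_inv c' p.
Proof.
move=> sub eqs sub' [hr hs]; split; rewrite eqs.
  by move=> m /hr[vm gm]; split=> //; apply: genuine_sub gm.
case: (run _) hs => [s|] hs; first exact: local_inv_sub hs.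
by move=> b /sub'; apply: hs.
Qed.

(** Serves every event in which a correct process acts. What it relays is genuine, so any correct
    author had sent it before, and [B] bounds the newly authored bodies. *)
Lemma config_inv_update (c : config) p ps out B :
  config_inv c -> p \notin faulty ->
  rcvd ps = rcvd (states c p) ->
  authored_or_relayed p B (rcvd (states c p)) out ->
  (if run ps is Some s
   then local_inv (fun b => sent c p b \/ B b) (rcvd (states c p)) s
   else forall b, ~ sent c p b /\ ~ B b) ->
  config_inv (update c p ps out).
Proof.
move=> [hnet hproc] pF eqr hout hs.
have sub : {subset network c <= network (update c p ps out)}.
  by move=> x; rewrite /= mem_cat => ->.
have [hr _] := hproc p pF.
have sent_new q b : q \notin faulty -> sent (update c p ps out) q b ->
    sent c q b \/ q = p /\ B b.
  move=> qF [x [/=]]; rewrite mem_cat => /orP[xc|/hout[-> hm]] ox mx.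
    by left; exists x.
  have [/hr[_ gm]|[b' Bb' [-> ->]]] := hm _ mx; last by right.
  by left; apply: gm.
split.
  move=> x m /=; rewrite mem_cat => /orP[xc mx|xout mx].
    exact: genuine_sub (hnet x m xc mx).
  have [ox hm] := hout _ xout.
  have [/hr[_ gm]|[b Bb em]] := hm _ mx; first exact: genuine_sub gm.
  by move=> _ _; exists x; rewrite em /= mem_cat xout orbT -em.
move=> q qF; have [->|neq] := eqVneq q p; last first.
  apply: process_inv_other (hproc q qF) => //.
    by rewrite /= ffunE (negPf neq).
  by move=> b /(sent_new q b qF)[//|[eqp]]; rewrite eqp eqxx in neq.
rewrite /process_inv /= ffunE eqxx eqr; split.
  by move=> m /hr[vm gm]; split=> //; apply: genuine_sub gm.
case: (run ps) hs => [s|] hs.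
  apply: local_inv_sub hs => // b /(sent_new p b pF)[|[]]; by [left|right].
by move=> b /(sent_new p b pF)[|[_]]; case: (hs b).
Qed.

Lemma config_inv_step now (c c' : config) e :
  step f leader beta t l faulty now c e c' -> config_inv c -> config_inv c'.
Proof.
case=> {e c'}.
- move=> p v pF runN inv; have := inv.2 p pF; rewrite /process_inv runN.
  move=> -[_ nosent].
  apply: (@config_inv_update _ _ _ _ (eq (PrePrepare l 1 v))) => //=.
    rewrite /start_output; case: ifP => // _; exact: authored_broadcast.
  (* Only a PRE-PREPARE can have been sent, so the clauses on sent messages hold vacuously. *)
  by split=> //=; move=> *;
    repeat match goal with H : sent _ _ _ \/ _ |- _ =>
      case: H => [/nosent|] // end.
- move=> x xc dF [hnet hproc].
  set c' := update _ _ _ _.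
  have subc : {subset network c <= network c'} by move=> y; rewrite /= cats0.
  have subc' b q : sent c' q b -> sent c q b.
    by move=> [y [/=]]; rewrite cats0; exists y.
  split.
    move=> y m /=; rewrite cats0 => yc my; exact: genuine_sub (hnet y m yc my).
  move=> q qF; have [eqq|neq] := eqVneq q (dest x); last first.
    apply: process_inv_other (hproc q qF) => // [|b]; last exact: subc'.
    by rewrite /= ffunE (negPf neq).
  have [hr hs] := hproc q qF; rewrite /process_inv /= ffunE eqq eqxx /= -eqq.
  split.
    move=> m; rewrite mem_cat mem_filter => /orP[/hr|/andP[vm mx]]; last first.
      by split=> //; apply: genuine_sub (hnet x m xc mx).
    by case=> vm gm; split=> //; apply: genuine_sub gm.
  case: (run _) hs => [s|] hs; last by move=> b /subc'; apply: hs.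
  apply: local_inv_sub hs => [b|m]; first exact: subc'.
  by rewrite mem_cat => ->.
- move=> p rl ps out pF pstep inv; have [_] := inv.2 p pF.
  case: {rl ps out} pstep => [rl s s' out runS nfired up|m s v Q runS _ _ dQ].
    rewrite runS => linv.
    have [B [hout linv']] := upon_inv up nfired linv.
    exact: (@config_inv_update _ _ _ _ B).
  rewrite runS => linv.
  (* The forwarded quorum was received in full, so nothing new is authored. *)
  have [r /andP[/quorum_subset subQ _]] := decided_commit linv dQ.
  apply: (@config_inv_update _ _ _ _ (fun=> False)) => //=.
    by move=> x; rewrite inE => /eqP->; split=> //= m' /subQ; left.
  by apply: local_inv_sub linv => // b [].
- move=> x oF _ auth_x [hnet hproc].
  set c' := Config _ _.
  have subc : {subset network c <= network c'}.
    by move=> y yc; rewrite /= mem_rcons inE yc orbT.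
  split.
    move=> y m /=; rewrite mem_rcons inE => /orP[/eqP->|yc] my.
      (* Unforgeability: the correct author had already sent this message. *)
      move=> am nf; have [z [zc oz mz]] := auth_x m my am nf.
      exact: sent_sub subc (hnet z m zc mz am nf).
    exact: genuine_sub (hnet y m yc my).
  move=> q qF; apply: process_inv_other (hproc q qF) => // b [y [/=]].
  rewrite mem_rcons inE => /orP[/eqP->|yc] oy my; last by exists y.
  by rewrite -oy oF in qF.
- by [].
Qed.

(** * Growth of the network, and certificates *)

Lemma network_step now (c c' : config) e :
  step f leader beta t l faulty now c e c' ->
  {subset network c <= network c'}.
Proof.
by case=> //= *; move=> y yc; rewrite ?mem_cat ?mem_rcons ?inE yc ?orbT.
Qed.

(** A quorum freed from its receiver: it persists as the network grows, so quorums collected by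
    different processes at different times can be compared in one configuration. *)
Definition certified (c : config) (b : body L V) : Prop :=
  exists2 A : {set 'I_n}, (n + f) %/ 2 < #|A| &
    forall q, q \in A -> q \notin faulty -> sent c q b.

Lemma certified_sub (c c' : config) b :
  {subset network c <= network c'} -> certified c b -> certified c' b.
Proof.
by move=> sub [A cA hA]; exists A => // q qA qF; apply: sent_sub (hA q qA qF).
Qed.

Lemma rcvd_sent (c : config) p m :
  config_inv c -> p \notin faulty -> m \in rcvd (states c p) ->
  src m \notin faulty -> sent c (src m) (content m).
Proof.
by move=> [_ hproc] /hproc[hr _] /hr[/andP[am _] gm]; apply: gm.
Qed.

Lemma quorum_certified (c : config) p b Q :
  config_inv c -> p \notin faulty ->
  quorum_of f b (rcvd (states c p)) Q -> certified c b.
Proof.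
move=> inv pF /andP[qQ /allP hb].
exists [set q in [seq src m | m <- Q]]; first exact: quorum_senders qQ.
move=> q; rewrite inE => /mapP[m mQ ->] mF; rewrite -(eqP (hb m mQ)).
exact: rcvd_sent inv pF (quorum_subset qQ mQ) mF.
Qed.

(** * Locking of values by certified COMMITs *)

Hypothesis hf : #|faulty| <= f.

Lemma sent_local_inv (c : config) p b :
  config_inv c -> p \notin faulty -> sent c p b ->
  exists2 s, run (states c p) = Some s &
             local_inv (sent c p) (rcvd (states c p)) s.
Proof.
move=> [_ hproc] /hproc[_]; case: (run _) => [s|] h hb; first by exists s.
by case: (h b).
Qed.

Lemma commit_certified_prepare (c : config) r v :
  config_inv c -> certified c (Commit l r v) ->
  0 < r /\ certified c (Prepare l r v).
Proof.
move=> inv [A cA hA].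
(* Meeting a quorum with itself yields a correct member. *)
have [q [qA _ qF]] := quorums_meet hf cA cA.
have hq := hA q qA qF; have [s _ linv] := sent_local_inv inv qF hq.
have [Q qQ] := commit_prepared linv hq.
split; last exact: quorum_certified inv qF qQ.
by case/andP: (commit_round linv hq).
Qed.

Lemma prepare_certified_uniq (c : config) r v v' :
  config_inv c -> certified c (Prepare l r v) -> certified c (Prepare l r v') ->
  v = v'.
Proof.
move=> inv [A cA hA] [B cB hB].
have [q [qA qB qF]] := quorums_meet hf cA cB.
have [s _ linv] := sent_local_inv inv qF (hA q qA qF).
exact: (prepare_uniq linv (hA q qA qF) (hB q qB qF)).
Qed.

Lemma commit_locks_value (c : config) r v r' v' :
  config_inv c -> certified c (Commit l r v) -> r <= r' ->
  certified c (Prepare l r' v') -> v = v'.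
Proof.
move=> inv comm; have [r_gt0 prep] := commit_certified_prepare inv comm.
elim/ltn_ind: r' v' => r' IH v'; rewrite leq_eqVlt => /orP[/eqP<-|lt_r].
  exact: prepare_certified_uniq inv prep.
move=> [B cB hB].
have [q [qB _ qF]] := quorums_meet hf cB cB.
have hq := hB q qB qF; have [s _ linv] := sent_local_inv inv qF hq.
(* The exemption of round 1 cannot apply, as [0 < r < r']. *)
case: (prepare_justified linv hq) => [r'1|]; first by lia.
move=> [Q [h [/andP[qQ /allP rcQ] /andP[/mapP[mh mhQ eh] /allP hmax] J]]].
have [A cA hA] := comm.
have [p [pA]] := quorums_meet hf cA (quorum_senders qQ).
rewrite inE => /mapP[m mQ pm] pF.
have hc := hA p pA pF; have [sp _ linvp] := sent_local_inv inv pF hc.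
(* [p] sent both a COMMIT for [r] and the ROUND-CHANGE [m] for [r']; [round_change_commit] applies
   without knowing their order. *)
have le_m : le_prepared (Some r) (prepared_of m).1.
  have := rcvd_sent inv qF (quorum_subset qQ mQ).
  rewrite -pm => /(_ pF) sm; have := rcQ m mQ; move: sm.
  rewrite /is_round_change /prepared_of /round_of.
  case: (content m) => // l' r0 pr pv sm /andP[/eqP el /eqP er].
  rewrite el er in sm; exact: (round_change_commit linvp sm hc lt_r).
case: J => [/allP/(_ m mQ)/eqP em|[pr [Qp [ehp qQp]]]].
  by rewrite em in le_m.
have le_pr : r <= pr.
  have := hmax m mQ; rewrite ehp; move: le_m.
  by case: (prepared_of m).1 => //= x; apply: leq_trans.
(* The induction descends because the ROUND-CHANGE [mh] attaining the highest pair is valid. *)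
have lt_pr : pr < r'.
  have [/andP[_ vm] _] := (inv.2 q qF).1 _ (quorum_subset qQ mhQ).
  have := rcQ mh mhQ; move: vm eh; rewrite ehp.
  rewrite /is_round_change /prepared_of /round_of.
  case: (content mh) => // l' r0 pr0 pv0 /andP[_ lt0] [epr _] /andP[_ /eqP er].
  by rewrite -epr er in lt0.
exact: IH lt_pr _ le_pr (quorum_certified inv qF qQp).
Qed.

Lemma commits_agree (c : config) r v r' v' :
  config_inv c -> certified c (Commit l r v) -> certified c (Commit l r' v') ->
  v = v'.
Proof.
move=> inv h h'; have [_ prep] := commit_certified_prepare inv h.
have [_ prep'] := commit_certified_prepare inv h'.
have [le|/ltnW le] := leqP r r'; first exact: commit_locks_value inv h le prep'.
by apply/esym; apply: commit_locks_value inv h' le prep.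
Qed.

End Agreement.

Theorem theorem3 (R : realType) (L V : eqType) (n f : nat)
    (hn : 3 * f + 1 <= n)
    (leader : L -> nat -> 'I_n) (beta : pred V)
    (t : nat -> R) (ht : exponential t)
    (l : L) (faulty : {set 'I_n}) (hf : #|faulty| <= f)
    (X : execution R L V n)
    (hX : ibft_execution f leader beta t l faulty X)
    (i : 'I_n) (v : V) :
  i \notin faulty -> decides X i v ->
  ~ (exists (j : 'I_n) (v' : V),
       [/\ j \notin faulty, decides X j v' & v' <> v]).
Proof.
move=> iF di [j [v' [jF dj]]]; apply.
have [[h0 hstep _ _] _] := hX.
have inv k : config_inv f beta l faulty (conf X k).
  elim: k => [|k IH]; first by rewrite h0; apply: config_inv_initial.
  exact: config_inv_step (hstep k) IH.
have mono k d : {subset network (conf X k) <= network (conf X (k + d))}.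
  elim: d => [|d IH]; first by rewrite addn0.
  by move=> x /IH; rewrite addnS; apply: network_step (hstep _) x.
(* The shift [d] allows both decisions to be compared in configuration [ki + kj]. *)
have commit p w : p \notin faulty -> decides X p w -> exists k r, forall d,
    certified f faulty (conf X (k + d)) (Commit l r w).
  move=> pF [k [s [Q [runS dQ]]]].
  have [_] := (inv k).2 p pF; rewrite runS => linv.
  have [r qQ] := decided_commit linv dQ.
  exists k, r => d; apply: certified_sub (mono k d) _.
  exact: quorum_certified (inv k) pF qQ.
have [ki [ri hi]] := commit i v iF di.
have [kj [rj hj]] := commit j v' jF dj.
have hi' := hi kj; rewrite addnC in hi'.
exact: (commits_agree hf (inv _) (hj ki) hi').
Qed.
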